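(* For every integer $n\geq 1$, $$A_{N>O}(n)-B_{N>O}(n)=2p_e(n).$$
   Context: A partition of $n$ is a finite non-increasing sequence of positive integers (its parts) with sum $n$. An overpartition of $n$ is a partition of $n$ in which the first occurrence of each number may be overlined (so for each size $t$ at most one part of size $t$ is overlined); the size of a part $t$ or $\overline{t}$ is $t$, and the weight is the sum of sizes. For an overpartition $\pi$, let $SO(\pi)$ be the size of the smallest overlined part of $\pi$ if $\pi$ has overlined parts, and $SO(\pi)=0$ otherwise. Let $\ell_{N>O}(\pi)$ be the number of non-overlined parts of $\pi$ (counted with multiplicity) of size greater than $SO(\pi)$. $A_{N>O}(n)$ (resp. $B_{N>O}(n)$) is the number of overpartitions $\pi$ of $n$ with $\ell_{N>O}(\pi)$ even (resp. odd). $p_e(n)$ is the number of (ordinary) partitions of $n$ with an even number of parts. *)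

(* Defs.v *)
From mathcomp Require Import all_boot all_order all_algebra.
Set Implicit Arguments.
Unset Strict Implicit.
Unset Printing Implicit Defensive.

Definition is_partition (n : nat) (s : seq nat) : bool :=
  [&& sorted geq s, all (ltn 0) s & sumn s == n].

(* (t, false) stands for the part t and (t, true) for the overlined part. *)
Definition part : Type := (nat * bool)%type.

Definition sizes (s : seq part) : seq nat := [seq p.1 | p <- s].

(* [index t (sizes s)] is the position of the first part of size t, so the
   second conjunct says that only first occurrences are overlined. *)
Definition is_overpartition (n : nat) (s : seq part) : bool :=
  is_partition n (sizes s) &&
  all (fun i => let p := nth (0, false) s i in
                p.2 ==> (index p.1 (sizes s) == i)) (iota 0 (size s)).

Definition overlined_sizes (s : seq part) : seq nat :=
  [seq p.1 | p <- s & p.2].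

(* Starting the minimum at the head gives 0 when no part is overlined. *)
Definition SO (s : seq part) : nat :=
  let o := overlined_sizes s in \big[minn/head 0 o]_(t <- o) t.

Definition ell_NgtO (s : seq part) : nat :=
  count (fun p => ~~ p.2 && (SO s < p.1)) s.

(* A partition or overpartition of n has at most n parts, each of size at
   most n, so counting bounded sequences misses none of them. *)
Definition parts_of (n : nat) (s : n.-bseq ('I_n.+1 * bool)) : seq part :=
  [seq (val p.1, p.2) | p <- s].

Definition A_NgtO (n : nat) : nat :=
  #|[set s : n.-bseq ('I_n.+1 * bool) |
      is_overpartition n (parts_of s) & ~~ odd (ell_NgtO (parts_of s))]|.

Definition B_NgtO (n : nat) : nat :=
  #|[set s : n.-bseq ('I_n.+1 * bool) |
      is_overpartition n (parts_of s) & odd (ell_NgtO (parts_of s))]|.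

Definition p_e (n : nat) : nat :=
  #|[set s : n.-bseq 'I_n.+1 |
      is_partition n [seq val i | i <- s] & ~~ odd (size s)]|.

(* Main.v *)
Require Import Defs.
From mathcomp Require Import all_boot all_order all_algebra.
From mathcomp Require Import zify.

(* Toggling the overline of a first (hence largest) part preserves SO and
   changes the parity of ell_NgtO whenever some later part is overlined, so all
   such overpartitions cancel. The others are the partitions of n with the
   first part overlined or not; these have ell_NgtO equal to 0 and to the
   number of parts respectively, so that a partition contributes 2 if its
   number of parts is even and 0 otherwise. *)

Section HeadOverline.
Variable T : Type.
Implicit Types (s : seq (T * bool)) (r : seq T).

(** Both maps are polymorphic because they act on sequences over ['I_n.+1], which index the sums,
    and on their images over [nat], where overpartitions are defined. *)
Definition toggle_head s :=
  if s is p :: s' then (p.1, ~~ p.2) :: s' else [::].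

Definition overline_head (b : bool) r : seq (T * bool) :=
  if r is x :: r' then (x, b) :: [seq (y, false) | y <- r'] else [::].

Lemma size_toggle_head s : size (toggle_head s) = size s.
Proof. by case: s. Qed.

Lemma size_overline_head b r : size (overline_head b r) = size r.
Proof. by case: r => //= x r; rewrite size_map. Qed.

Lemma toggle_headK : involutive toggle_head.
Proof. by case=> [|[x b] s] //=; rewrite negbK. Qed.

Lemma overline_headK b r : map fst (overline_head b r) = r.
Proof. by case: r => //= x r; rewrite -map_comp map_id. Qed.

Lemma has_behead_toggle_head s :
  has snd (behead (toggle_head s)) = has snd (behead s).
Proof. by case: s. Qed.

Lemma has_behead_overline_head b r :
  has snd (behead (overline_head b r)) = false.
Proof. by case: r => //= x r; rewrite has_map; elim: r. Qed.

Lemma overline_head_fst s :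
  ~~ has snd (behead s) ->
  overline_head (head false (map snd s)) (map fst s) = s.
Proof.
case: s => [|[x b] s] //= Hs; congr cons.
by elim: s Hs => //= -[y []] s IH //= /IH->.
Qed.

Lemma toggle_head_bseq_subproof n (s : n.-bseq (T * bool)) :
  size (toggle_head s) <= n.
Proof. by rewrite size_toggle_head size_bseq. Qed.

Definition toggle_head_bseq n (s : n.-bseq (T * bool)) :=
  Bseq (toggle_head_bseq_subproof n s).

Lemma overline_head_bseq_subproof n b (r : n.-bseq T) :
  size (overline_head b r) <= n.
Proof. by rewrite size_overline_head size_bseq. Qed.

Definition overline_head_bseq n b (r : n.-bseq T) :=
  Bseq (overline_head_bseq_subproof n b r).

End HeadOverline.

Arguments toggle_head {T}.
Arguments overline_head {T}.
Arguments toggle_head_bseq {T n}.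
Arguments overline_head_bseq {T n}.

Lemma parts_of_toggle n (s : n.-bseq ('I_n.+1 * bool)) :
  parts_of (toggle_head_bseq s) = toggle_head (parts_of s).
Proof. by rewrite /parts_of /=; case: (val s). Qed.

Lemma parts_of_overline n b (r : n.-bseq 'I_n.+1) :
  parts_of (overline_head_bseq b r) = overline_head b (map val r).
Proof. by rewrite /parts_of /=; case: (val r) => //= x r'; rewrite -!map_comp. Qed.

Lemma has_behead_parts_of n (s : n.-bseq ('I_n.+1 * bool)) :
  has snd (behead (parts_of s)) = has snd (behead s).
Proof. by rewrite /parts_of behead_map has_map. Qed.

(** Position 0 is always the first occurrence of its size, so the overline condition there holds for
    either flag; the sizes and the later flags do not change. *)
Lemma is_overpartition_toggle_head n s :
  is_overpartition n (toggle_head s) = is_overpartition n s.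
Proof.
case: s => [|[t b] s] //=; rewrite /is_overpartition /= eqxx !implybT /=.
by congr andb; apply: eq_in_all => -[|i]; rewrite ?mem_iota.
Qed.

Lemma is_overpartition_overline_head n b r :
  is_overpartition n (overline_head b r) = is_partition n r.
Proof.
rewrite /is_overpartition /sizes overline_headK -[RHS]andbT; congr andb.
case: r => //= x r; rewrite eqxx implybT /= size_map.
apply/allP => -[|i]; rewrite mem_iota //= add1n ltnS => Hi.
by rewrite (nth_map 0).
Qed.

Lemma geq_head_sorted x y (r : seq nat) :
  sorted geq (x :: r) -> y \in r -> y <= x.
Proof.
have geq_trans : transitive geq by move=> b a c ba cb; exact: leq_trans cb ba.
by move=> /(order_path_min geq_trans)/allP/[apply].
Qed.

(** An overlined part is the first occurrence of its size, so a later one cannot have size [t];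
    monotonicity then makes the inequality strict. *)
Lemma overlined_tail_lt n t b s p :
  is_overpartition n ((t, b) :: s) -> p \in s -> p.2 -> p.1 < t.
Proof.
move=> /andP[/and3P[Hs _ _] /allP Hi] ps p2.
have Hj: index p s < size s by rewrite index_mem.
have := Hi (index p s).+1; rewrite mem_iota /= ltnS Hj => /(_ isT).
rewrite nth_index // p2 /=; case: (eqVneq t p.1) => //= ne _.
rewrite ltn_neqAle eq_sym ne /=.
by apply: geq_head_sorted _ _ _ Hs _; apply: map_f.
Qed.

Lemma minn_bigminn x (r : seq nat) :
  minn x (\big[minn/x]_(i <- r) i) = \big[minn/x]_(i <- r) i.
Proof.
elim: r => [|y r IH]; rewrite ?big_nil ?minnn // big_cons.
by rewrite minnCA IH.
Qed.

(** Since [minn] has no neutral element on [nat], the initial value of the minimum in [SO] matters;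
    this exchanges it with an outer argument. *)
Lemma bigminn_idx x y (r : seq nat) :
  minn y (\big[minn/x]_(i <- r) i) = minn x (\big[minn/y]_(i <- r) i).
Proof.
elim: r => [|z r IH]; first by rewrite !big_nil minnC.
rewrite !big_cons.
by rewrite !(minnCA _ z) IH.
Qed.

Lemma overlined_sizes_cons p s :
  overlined_sizes (p :: s) =
  if p.2 then p.1 :: overlined_sizes s else overlined_sizes s.
Proof. by rewrite /overlined_sizes /=; case: p.2. Qed.

(** Overlined parts of the tail are smaller than [t], so [t] never affects the minimum, overlined or
    not. *)
Lemma SO_cons n t b s :
  is_overpartition n ((t, b) :: s) -> has snd s ->
  SO ((t, b) :: s) = SO s /\ SO s < t.
Proof.
move=> Ho Hs.
have : all (fun u => u < t) (overlined_sizes s).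
  apply/allP => u /mapP[p]; rewrite mem_filter => /andP[p2 ps] ->.
  exact: overlined_tail_lt _ _ _ _ _ Ho ps p2.
have : overlined_sizes s != [::].
  by rewrite -size_eq0 size_map size_filter -lt0n -has_count.
rewrite /SO overlined_sizes_cons.
case: (overlined_sizes s) => // u o _ /andP[ut _].
case: b Ho => _ /=; rewrite !big_cons; last by split=> //; rewrite gtn_min ut.
(* With [t] overlined, the minimum starts at [t] rather than at [u]. *)
rewrite (bigminn_idx t u) minnA minnn.
by have := minn_bigminn u o; lia.
Qed.

(** As [SO] is unchanged and less than the first part, toggling only decides whether that part is
    counted. *)
Lemma odd_ell_toggle_head n s :
  is_overpartition n s -> has snd (behead s) ->
  odd (ell_NgtO (toggle_head s)) = ~~ odd (ell_NgtO s).
Proof.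
case: s => [|[t b] s] //= Ho Hs.
have Ho' : is_overpartition n ((t, ~~ b) :: s).
  by rewrite -(is_overpartition_toggle_head n (_ :: _)) /= negbK.
have [E lt] := SO_cons _ _ _ _ Ho Hs; have [E' _] := SO_cons _ _ _ _ Ho' Hs.
by rewrite /ell_NgtO /= E E' lt !andbT; case: b {Ho Ho' E E'} => /=; lia.
Qed.

Lemma overlined_sizes_none (r : seq nat) :
  overlined_sizes [seq (y, false) | y <- r] = [::].
Proof. by elim: r. Qed.

(** Here [SO] is 0, and all parts are positive. *)
Lemma ell_overline_head_false n r :
  is_partition n r -> ell_NgtO (overline_head false r) = size r.
Proof.
case: r => [|x r] // /and3P[_ /= /andP[x0 r0] _].
rewrite /ell_NgtO /SO overlined_sizes_cons overlined_sizes_none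
  /= big_nil x0 count_map; congr S.
by apply/eqP; rewrite -all_count.
Qed.

(** Here [SO] is the largest part, which no part exceeds. *)
Lemma ell_overline_head_true n r :
  is_partition n r -> ell_NgtO (overline_head true r) = 0.
Proof.
case: r => [|x r] // /and3P[Hs _ _].
rewrite /ell_NgtO /SO overlined_sizes_cons overlined_sizes_none
  /= big_cons big_nil minnn count_map.
apply/eqP; rewrite -leqn0 leqNgt -has_count; apply/hasPn => y yr /=.
by rewrite -leqNgt; apply: geq_head_sorted _ _ _ Hs yr.
Qed.

Import GRing.Theory Num.Theory.

Local Open Scope ring_scope.

Lemma card_even_sub_odd (T : finType) (P : pred T) (f : T -> nat) :
  #|[set x | P x & ~~ odd (f x)]|%:Z - #|[set x | P x & odd (f x)]|%:Z
  = \sum_(x | P x) (-1) ^+ f x.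
Proof.
rewrite (bigID (odd \o f)) /= addrC -!sum1dep_card -!natz !natr_sum -sumrN.
by congr +%R; apply: eq_bigr => x /andP[_ Hx];
  rewrite -signr_odd ?Hx ?(negPf Hx).
Qed.

Lemma sum_overlined_tail n :
  \sum_(s : n.-bseq ('I_n.+1 * bool) |
      is_overpartition n (parts_of s) && has snd (behead s))
    (-1) ^+ ell_NgtO (parts_of s) = 0 :> int.
Proof.
(* Reindexing along the sign-reversing involution gives [S = - S]. *)
set S := \sum_(s | _) _; suff : S = - S by lia.
have tK : involutive (@toggle_head_bseq 'I_n.+1 n).
  by move=> s; apply: val_inj; rewrite /= toggle_headK.
rewrite {1}/S (reindex_inj (inv_inj tK)) -sumrN; apply: eq_big => s.
  by rewrite parts_of_toggle is_overpartition_toggle_head /= has_behead_toggle_head.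
rewrite parts_of_toggle is_overpartition_toggle_head /= has_behead_toggle_head.
move=> /andP[Ho Hs]; rewrite -signr_odd (odd_ell_toggle_head _ _ Ho).
  by rewrite signrN signr_odd.
by rewrite has_behead_parts_of.
Qed.

Lemma sum_plain_tail n : (0 < n)%N ->
  \sum_(s : n.-bseq ('I_n.+1 * bool) |
      is_overpartition n (parts_of s) && ~~ has snd (behead s))
    (-1) ^+ ell_NgtO (parts_of s) = 2 * (p_e n)%:Z.
Proof.
move=> n0.
pose h (x : n.-bseq 'I_n.+1 * bool) := overline_head_bseq x.2 x.1.
pose h' (s : n.-bseq ('I_n.+1 * bool)) :=
  ([bseq of map fst s], head false (map snd s)).
rewrite (reindex_onto h h'); last first.
  by move=> s /andP[_ Hs]; apply: val_inj; rewrite /= overline_head_fst.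
rewrite (eq_bigl (fun x : n.-bseq 'I_n.+1 * bool =>
  is_partition n (map val x.1) && true)); last first.
  case=> r b; rewrite /h /= parts_of_overline is_overpartition_overline_head.
  rewrite has_behead_overline_head !andbT.
  case: (boolP (is_partition _ _)) => //= Hr.
  apply/eqP; congr pair; first by apply: val_inj; rewrite /= overline_headK.
  (* The flag can be read back from the first part unless [r] is empty, which [0 < n] excludes. *)
  by case: r Hr => -[] // _ /and3P[_ _ /= /eqP E]; rewrite -E in n0.
rewrite -(pair_big (fun r : n.-bseq 'I_n.+1 => is_partition n (map val r)) xpredT
  (fun r b => (-1) ^+ ell_NgtO (parts_of (h (r, b))))) /=.
rewrite /p_e -sum1dep_card -natz natr_sum mulr_sumr [RHS]big_mkcondr /=.
(* The two flags contribute [1] and [(-1) ^+ size r], with sum 2 or 0 according to the parity of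
   [size r]. *)
apply: eq_bigr => r Hr; rewrite big_bool /= !parts_of_overline.
rewrite (ell_overline_head_true _ _ Hr) (ell_overline_head_false _ _ Hr) size_map.
by rewrite expr0 -signr_odd; case: odd.
Qed.

Theorem theorem2p6 (n : nat) (hn : (1 <= n)%N) :
  (A_NgtO n)%:Z - (B_NgtO n)%:Z = 2 * (p_e n)%:Z.
Proof.
rewrite card_even_sub_odd (bigID (fun s => has snd (behead (val s)))) /=.
by rewrite sum_overlined_tail sum_plain_tail // add0r.
Qed.
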